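(* Let $\mathbf{k}$ be a field and let $\mathbf{H}_*$ be one of the link homology theories $\widetilde{\mathrm{Kh}}(\,\cdot\,;\mathbf{k})$ (reduced Khovanov homology) or $\widehat{\mathrm{HFK}}(\,\cdot\,;\mathbf{k})$ (knot Floer homology). If $\mathbf{H}_*$ has full support, then a link is thin if and only if it is an A-link (both with respect to $\mathbf{H}_*$).
   Context: Links lie in $S^3$. $\widetilde{\mathrm{Kh}}$ carries the homological grading $h$ and quantum grading $q$, and $\delta=\frac12q-h$; $\widehat{\mathrm{HFK}}$ carries the homological (Maslov) grading $h$ and $A$, which is twice the usual Alexander grading, and $\delta=\frac12A-h$. For a fixed link all $\delta$-gradings in the support differ by integers. Write $\mathbf{H}_i(L)$ for the part of $\mathbf{H}_*(L)$ in $\delta$-grading $i$ and $\chi_\delta\mathbf{H}_*(L)=\sum_i(-1)^i\dim\mathbf{H}_i(L)$ (only the absolute value matters). A link $L$ is thin if $\mathbf{H}_*(L)$ is supported in at most one $\delta$-grading. A link $L$ is an A-link if $\dim\mathbf{H}_*(L)=|\chi_\delta\mathbf{H}_*(L)|$. The theory $\mathbf{H}_*$ has full support if for all links $L$ and all $\delta$-gradings $i<j<k$ (differing by integers), $\mathbf{H}_i(L)\neq0$ and $\mathbf{H}_k(L)\neq0$ imply $\mathbf{H}_j(L)\neq0$. *)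

(* Defs.v *)
From HB Require Import structures.
From mathcomp Require Import all_boot all_order all_fingroup all_algebra.

Set Implicit Arguments.
Unset Strict Implicit.
Unset Printing Implicit Defensive.

Import Order.TTheory GRing.Theory Num.Theory.
Local Open Scope ring_scope.

(* A based oriented link in S^3 is encoded by a planar grid diagram: column i
   has its O in row [gridO i] and its X in row [gridX i].  Columns are joined
   by vertical segments oriented from X to O, rows by horizontal segments
   oriented from O to X, and vertical segments pass over horizontal ones.
   Every link in S^3 has such a diagram.  The O in column [base] marks the base
   point that reduced Khovanov homology requires. *)
Record link := Link {
  arcs : nat;
  gridO : 'S_arcs;
  gridX : 'S_arcs;
  base : 'I_arcs;
  gridOX : forall i, gridO i != gridX i
}.

(* The link component of column i is [porbit (next_column L) i]: follow
   column i to its O, then the row of that O to its X. *)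
Definition next_column (L : link) : 'S_(arcs L) := (gridO L * (gridX L)^-1)%g.

Definition components (L : link) : nat := #|porbits (next_column L)|.

(* Complexes with a distinguished finite bigraded basis.  [coef a b] is the
   coefficient of b in the boundary of a. *)
Record based_complex (k : fieldType) := BasedComplex {
  gen : finType;
  hdeg : gen -> int;
  qdeg : gen -> int;
  coef : gen -> gen -> k
}.

Section Homology.
Variables (k : fieldType) (C : based_complex k).

Definition chains := {ffun gen C -> k^o}.

Definition boundary : 'End(chains) :=
  linfun (fun u : chains => [ffun b => \sum_a u a * coef a b] : chains).

Definition delta (g : gen C) : rat := (qdeg g)%:~R / 2 - (hdeg g)%:~R.

Definition elementary (g : gen C) : chains := [ffun g' => (g' == g)%:R].

Definition homogeneous (i : rat) : {vspace chains} :=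
  <<[seq elementary g | g <- enum (gen C) & delta g == i]>>%VS.

(* The quotient of cycles by boundaries in delta-grading i is realized as a
   complement of the boundaries inside the space of cycles. *)
Definition homology (i : rat) : {vspace chains} :=
  ((lker boundary :&: homogeneous i) :\: limg boundary)%VS.

Definition deltas : seq rat := undup [seq delta g | g <- enum (gen C)].

Definition total_dim : nat := (\sum_(i <- deltas) \dim (homology i))%N.

(* Only i mod 2 up to a common shift matters in the sign (-1)^i, since the
   delta-gradings of a link differ by integers; half-integers are rounded
   down. *)
Definition euler_delta : int :=
  \sum_(i <- deltas) (-1) ^+ `|Num.floor i|%N * (\dim (homology i))%:Z.

End Homology.

Section Khovanov.
Variable L : link.
Let n := arcs L.

Definition cell := ('I_n * 'I_n)%type.

(* The four sides of a cell: the first component tells north/south (true) from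
   east/west (false), the second tells north/east (true) from south/west. *)
Definition side := (bool * bool)%type.

(* A dart is half of a unit edge of the lattice of cells, namely the half lying
   in the given cell and ending on the given side of it. *)
Definition dart := (cell * side)%type.

Definition strictly_between (a b c : nat) : bool :=
  (minn a b < c < maxn a b)%N.

Definition is_crossing (c : cell) : bool :=
  strictly_between ((gridO L)^-1%g c.2) ((gridX L)^-1%g c.2) c.1
  && strictly_between (gridO L c.1) (gridX L c.1) c.2.

Definition crossings : {set cell} := [set c | is_crossing c].

(* Upward over-strand with leftward under-strand, or downward with
   rightward. *)
Definition positive (c : cell) : bool :=
  (gridX L c.1 < gridO L c.1)%N
  == ((gridX L)^-1%g c.2 < (gridO L)^-1%g c.2)%N.

Definition n_pos : nat := #|[set c in crossings | positive c]|.
Definition n_neg : nat := #|[set c in crossings | ~~ positive c]|.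

(* The dart lies on the link diagram. *)
Definition occupied (d : dart) : bool :=
  let: (c, (vertical, upper)) := d in
  let a : nat := if vertical then gridO L c.1 else (gridO L)^-1%g c.2 in
  let b : nat := if vertical then gridX L c.1 else (gridX L)^-1%g c.2 in
  let p : nat := if vertical then c.2 else c.1 in
  if upper then (minn a b <= p < maxn a b)%N else (minn a b < p <= maxn a b)%N.

(* d and e are the two halves of one edge, e being to the north or to the east
   of d. *)
Definition glued (d e : dart) : bool :=
  [&& d.2.1 == e.2.1, d.2.2, ~~ e.2.2 &
    if d.2.1 then (e.1.1 == d.1.1) && (e.1.2 == d.1.2.+1 :> nat)
    else (e.1.1 == d.1.1.+1 :> nat) && (e.1.2 == d.1.2)].

(* d and e are joined inside their cell in the state s, where s is the set of
   1-smoothed crossings.  As the vertical strand is the over-strand, the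
   0-smoothing joins north to east and south to west, the 1-smoothing north to
   west and south to east. *)
Definition joined (s : {set cell}) (d e : dart) : bool :=
  (d.1 == e.1) &&
  (is_crossing d.1 ==>
     (d.2.1 != e.2.1) && ((d.2.2 == e.2.2) == (d.1 \notin s))).

Definition adjacent (s : {set cell}) : rel dart :=
  fun d e => [&& occupied d, occupied e &
                 [|| glued d e, glued e d | joined s d e]].

Definition circle (s : {set cell}) (d : dart) : {set dart} :=
  [set e | connect (adjacent s) d e].

Definition circles (s : {set cell}) : {set {set dart}} :=
  [set circle s d | d in [set d | occupied d]].

Definition marked (A : {set dart}) : bool :=
  [exists d in A, d.1 == (base L, gridO L (base L))].

(* An enhanced state (s, P): P is the union of the circles labelled v_+ (that
   is, 1), the others being labelled v_- (that is, x).  The reduced complex is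
   the subcomplex on which the marked circle is labelled v_-. *)
Definition enhanced (g : {set cell} * {set dart}) : bool :=
  let: (s, P) := g in
  [&& s \subset crossings,
      [exists A : {set {set dart}}, (A \subset circles s) && (P == cover A)] &
      ~~ marked P].

Definition kh_gen := {g : {set cell} * {set dart} | enhanced g}.

Definition plus_circles (s : {set cell}) (P : {set dart}) : {set {set dart}} :=
  [set A in circles s | A \subset P].

Definition minus_circles (s : {set cell}) (P : {set dart}) : {set {set dart}} :=
  [set A in circles s | ~~ (A \subset P) & ~~ marked A].

Definition kh_hdeg (g : kh_gen) : int := #|(val g).1|%:Z - n_neg%:Z.

(* The marked circle contributes 0, so the unknot lies in q-grading 0. *)
Definition kh_qdeg (g : kh_gen) : int :=
  let: (s, P) := val g in
  #|plus_circles s P|%:Z - #|minus_circles s P|%:Z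
  + #|s|%:Z + n_pos%:Z - 2 * n_neg%:Z.

Definition circles_at (c : cell) (s : {set cell}) : {set {set dart}} :=
  [set A in circles s | [exists d in A, d.1 == c]].

(* With a circles through c before the change of smoothing, p of them labelled
   v_+, and p' circles labelled v_+ after it: for a = 2 this is
   v_+v_+ -> v_+, v_+v_- -> v_-, v_-v_- -> 0; for a = 1 it is
   v_+ -> v_+v_- + v_-v_+, v_- -> v_-v_-. *)
Definition edge_map (c : cell) (s : {set cell}) (P P' : {set dart}) : bool :=
  let a := #|circles_at c s| in
  let p := #|circles_at c s :&: plus_circles s P| in
  let p' := #|circles_at c (c |: s) :&: plus_circles (c |: s) P'| in
  (P :\: cover (circles_at c s) == P' :\: cover (circles_at c s))
  && (if a == 2%N then p == p'.+1 else p == p').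

Definition preceding (c : cell) (s : {set cell}) : nat :=
  #|[set e in s | (enum_rank e < enum_rank c)%N]|.

Definition kh_coef (k : fieldType) (g g' : kh_gen) : k :=
  let: (s, P) := val g in
  let: (s', P') := val g' in
  \sum_(c in crossings | [&& c \notin s, s' == c |: s & edge_map c s P P'])
    (-1) ^+ preceding c s.

End Khovanov.

Definition reduced_khovanov (k : fieldType) (L : link) : based_complex k :=
  @BasedComplex k (kh_gen L) (@kh_hdeg L) (@kh_qdeg L) (@kh_coef L k).

Section ToroidalGrid.
Variable n : nat.

(* The grid state x consists of the lattice points (i, x i) on the torus.  A
   rectangle leaving x is given by p = (i, j) with i != j: its lower left and
   upper right corners are (i, x i) and (j, x j), so it consists of the squares
   in the cyclic column interval [i, j) and cyclic row interval [x i, x j). *)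
Definition in_cyclic (a b c : 'I_n) : bool :=
  if (a < b)%N then (a <= c < b)%N else (a <= c)%N || (c < b)%N.

Definition covers (x : 'S_n) (p : 'I_n * 'I_n) (a b : 'I_n) : bool :=
  in_cyclic p.1 p.2 a && in_cyclic (x p.1) (x p.2) b.

(* No point of x lies in the interior of the rectangle. *)
Definition empty_rect (x : 'S_n) (p : 'I_n * 'I_n) : bool :=
  (p.1 != p.2) && [forall c, (c != p.1) ==> ~~ covers x p c (x c)].

Definition target (x : 'S_n) (p : 'I_n * 'I_n) : 'S_n := (tperm p.1 p.2 * x)%g.

(* Sign assignments on empty rectangles, true standing for the sign -1: two
   decompositions of the same domain have opposite signs, vertical annuli have
   sign -1 and horizontal annuli have sign 1.  They exist for all n and are
   unique up to rescaling the grid states by signs (Manolescu, Ozsvath, Szabo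
   and Thurston, On combinatorial link Floer homology). *)
Record sign_assignment := SignAssignment {
  sgn : 'S_n -> 'I_n * 'I_n -> bool;
  sgn_square : forall x p q p' q',
    empty_rect x p -> empty_rect (target x p) q ->
    empty_rect x p' -> empty_rect (target x p') q' ->
    p != p' ->
    target (target x p) q = target (target x p') q' ->
    (forall a b, (covers x p a b + covers (target x p) q a b
                  = covers x p' a b + covers (target x p') q' a b)%N) ->
    sgn x p (+) sgn (target x p) q = ~~ (sgn x p' (+) sgn (target x p') q');
  sgn_vertical : forall x i j,
    empty_rect x (i, j) -> empty_rect (target x (i, j)) (i, j) ->
    sgn x (i, j) (+) sgn (target x (i, j)) (i, j) = true;
  sgn_horizontal : forall x i j,
    empty_rect x (i, j) -> empty_rect (target x (i, j)) (j, i) ->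
    sgn x (i, j) (+) sgn (target x (i, j)) (j, i) = false
}.

End ToroidalGrid.

Section KnotFloer.
Variable L : link.
Let n := arcs L.

(* [noninversions x] is I(x, x), and [southwest x M] is I(x, M) + I(M, x), where
   I(P, Q) counts the pairs with the point of P strictly to the left of and
   below the point of Q; the markings sit at (i + 1/2, M i + 1/2). *)
Definition noninversions (x : 'S_n) : nat :=
  #|[set p : 'I_n * 'I_n | (p.1 < p.2)%N && (x p.1 < x p.2)%N]|.

Definition southwest (x M : 'S_n) : nat :=
  (#|[set p : 'I_n * 'I_n | (p.1 <= p.2)%N && (x p.1 <= M p.2)%N]|
   + #|[set p : 'I_n * 'I_n | (p.1 < p.2)%N && (M p.1 < x p.2)%N]|)%N.

Definition maslov (M x : 'S_n) : int :=
  (noninversions x)%:Z - (southwest x M)%:Z + (noninversions M)%:Z + 1.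

(* Twice the Alexander grading, summed over the components of the link. *)
Definition alexander (x : 'S_n) : int :=
  maslov (gridO L) x - maslov (gridX L) x - (n%:Z - (components L)%:Z).

(* One O on each component of the link, whose variable is set to 0. *)
Definition blocked (i : 'I_n) : bool :=
  [forall j in porbit (next_column L) i, (i <= j)%N].

(* Strictly larger than every exponent that occurs below. *)
Definition exponent_bound : nat :=
  (\max_x \max_y `|alexander x - alexander y|%N).+1.

Definition monomial := {ffun 'I_n -> 'I_exponent_bound}.

Definition degree (m : monomial) : nat := (\sum_i m i)%N.

(* Generators x * V^m of the simply blocked grid complex over k.  That complex
   is infinite-dimensional, but it is the direct sum of its finite-dimensional
   parts in each Alexander grading.  Only the Alexander gradings not below that
   of every grid state are kept: in the others it is acyclic, because the
   homology of the fully blocked complex, which is generated by the grid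
   states, is the tensor product of the simply blocked homology with
   (k_(0,0) + k_(-1,-1))^(n - components). *)
Definition floer_generator (g : 'S_n * monomial) : bool :=
  let: (x, m) := g in
  [forall i, blocked i ==> (m i == 0%N :> nat)]
  && [exists y, alexander y <= alexander x - 2 * (degree m)%:Z].

Definition hfk_gen := {g : 'S_n * monomial | floer_generator g}.

Definition hfk_hdeg (g : hfk_gen) : int :=
  let: (x, m) := val g in maslov (gridO L) x - 2 * (degree m)%:Z.

Definition hfk_adeg (g : hfk_gen) : int :=
  let: (x, m) := val g in alexander x - 2 * (degree m)%:Z.

(* The sum of S(r) V^(O(r)) y over the empty rectangles r from x to y that
   contain no X; rectangles containing a blocked O drop out because the
   exponent of its variable is 0 in every generator. *)
Definition hfk_coef (k : fieldType) (S : sign_assignment n) (g g' : hfk_gen) : k :=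
  let: (x, m) := val g in
  let: (y, m') := val g' in
  \sum_(p | [&& empty_rect x p, y == target x p,
                [forall c, ~~ covers x p c (gridX L c)] &
                [forall c, m' c == (m c + covers x p c (gridO L c))%N :> nat]])
    (-1) ^+ sgn S x p.

End KnotFloer.

Definition knot_floer (k : fieldType) (S : forall n, sign_assignment n)
    (L : link) : based_complex k :=
  @BasedComplex k (hfk_gen L) (@hfk_hdeg L) (@hfk_adeg L)
    (@hfk_coef L k (S (arcs L))).

(* Knot Floer homology over k is defined through a choice of sign assignments,
   on which it does not depend up to isomorphism. *)
Inductive theory :=
  | Kh
  | HFK of (forall n, sign_assignment n).

Definition complex_of (k : fieldType) (T : theory) (L : link) : based_complex k :=
  match T with
  | Kh => reduced_khovanov k L
  | HFK sg => knot_floer k sg L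
  end.

Definition supported (k : fieldType) (T : theory) (L : link) (i : rat) : Prop :=
  homology (complex_of k T L) i <> 0%VS.

Definition thin (k : fieldType) (T : theory) (L : link) : Prop :=
  forall i j, supported k T L i -> supported k T L j -> i = j.

Definition A_link (k : fieldType) (T : theory) (L : link) : Prop :=
  total_dim (complex_of k T L) = `|euler_delta (complex_of k T L)|%N.

Definition full_support (k : fieldType) (T : theory) : Prop :=
  forall (L : link) (i j l : rat),
    j - i \is a Num.int -> l - j \is a Num.int -> i < j -> j < l ->
    supported k T L i -> supported k T L l -> supported k T L j.

(* Main.v *)
Require Import Defs.
From mathcomp Require Import all_boot all_order all_fingroup all_algebra.
From mathcomp Require Import zify ring.

(** A thin link has its whole homology in one delta-grading, so the Euler
    characteristic is that dimension up to sign.  Conversely, the dimension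
    equals the absolute value of the Euler characteristic only if no
    cancellation takes place, so the delta-gradings of the support all have
    the same parity.  If two of them were distinct, say i < j, then j - i would
    be a positive integer and full support would put homology in grading i + 1
    as well (or j would be i + 1), which has the wrong parity.

    The topology enters through the integrality of j - i.  It is proved for the
    generators of the chain complexes: as delta = q / 2 - h with h an integer,
    the point is that q has a constant parity ([kh_qdeg_odd], [hfk_adeg_odd]).

    For knot Floer homology, the number [southwest x M] enters the Alexander
    grading, and it has the parity of the grid number whatever the grid state x
    ([southwest_double]).

    For Khovanov homology, the q-degree of an enhanced state has the parity of
    the number of circles plus the number of 1-smoothings, up to a constant, so
    the point is that changing one smoothing changes the number of circles by
    an odd number.  This is where planarity is used: the faces of the diagram
    have a checkerboard colouring, and orienting every edge with its black face
    on the left makes each crossing alternate between incoming and outgoing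
    ends.  Both smoothings respect such an orientation.  Hence the circles of a
    state are the cycles of a permutation of the ingoing darts, changing one
    smoothing composes this permutation with the transposition of the two
    ingoing darts at the crossing ([turn_flip]), and the signature of a
    permutation determines the parity of its number of cycles. *)

Set Implicit Arguments.
Unset Strict Implicit.
Unset Printing Implicit Defensive.

Import Order.TTheory GRing.Theory Num.Theory.
Local Open Scope ring_scope.

(** * The Euler characteristic and the parity of delta-gradings *)

Definition floor_odd (i : rat) : bool := odd `|Num.floor i|.

Lemma floor_oddD1 i : floor_odd (i + 1) = ~~ floor_odd i.
Proof.
rewrite /floor_odd floorDrz ?rpred1 // floor1.
by case: (Num.floor i) => m; lia.
Qed.

Section Homology.
Variables (k : fieldType) (C : based_complex k).

Lemma homology_deltas i : homology C i <> 0%VS -> i \in deltas C.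
Proof.
move=> Hi; rewrite mem_undup; apply/negP => /negP Hn; apply: Hi.
have homogeneous0 : homogeneous C i = 0%VS.
  rewrite /homogeneous.
  suff -> : [seq g <- enum (gen C) | delta g == i] = [::] by rewrite span_nil.
  case E : (filter _ _) => [|g s] //=.
  have : g \in [seq g <- enum (gen C) | delta g == i] by rewrite E mem_head.
  rewrite mem_filter => /andP[/eqP gi _].
  by case/negP: Hn; apply/mapP; exists g; rewrite ?mem_enum.
apply/eqP; rewrite -subv0; apply: subv_trans (diffvSl _ _) _.
by rewrite homogeneous0 capv0.
Qed.

Lemma homology_dim i : homology C i <> 0%VS -> (0 < \dim (homology C i))%N.
Proof. by move/eqP; rewrite -dimv_eq0 lt0n. Qed.

(** The dimension of the even ([b = false]) or odd ([b = true]) part. *)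
Definition parity_dim b : nat :=
  (\sum_(i <- deltas C | floor_odd i == b) \dim (homology C i))%N.

Lemma parity_dim_gt0 i : homology C i <> 0%VS -> (0 < parity_dim (floor_odd i))%N.
Proof.
move=> Hi; rewrite lt0n sum_nat_seq_neq0; apply/hasP.
by exists i; rewrite ?homology_deltas // eqxx -lt0n homology_dim.
Qed.

Lemma total_dimE : total_dim C = (parity_dim true + parity_dim false)%N.
Proof.
rewrite /total_dim (bigID floor_odd) /=; congr (_ + _)%N; apply: eq_bigl => i.
  by case: floor_odd.
by case: floor_odd.
Qed.

Lemma euler_deltaE : euler_delta C = (parity_dim false)%:Z - (parity_dim true)%:Z.
Proof.
rewrite /euler_delta (bigID floor_odd) /= addrC /parity_dim
  !(big_morph Posz PoszD (erefl _)).
rewrite -sumrN; congr (_ + _).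
  apply: eq_big => [i|i /negbTE Hi]; first by case: floor_odd.
  by rewrite -signr_odd -/(floor_odd i) Hi expr0 mul1r.
apply: eq_big => [i|i Hi]; first by case: floor_odd.
by rewrite -signr_odd -/(floor_odd i) Hi expr1 mulN1r.
Qed.

(** The Euler characteristic is a difference of two natural numbers whose sum is
    the total dimension; equality in absolute value forces one of them to be
    0. *)
Lemma floor_odd_support i j :
  total_dim C = `|euler_delta C|%N ->
  homology C i <> 0%VS -> homology C j <> 0%VS -> floor_odd i = floor_odd j.
Proof.
rewrite total_dimE euler_deltaE => HA /parity_dim_gt0 Hi /parity_dim_gt0 Hj.
by move: Hi Hj; case: floor_odd; case: floor_odd => //; lia.
Qed.

Lemma total_dim_thin :
  (forall i j, homology C i <> 0%VS -> homology C j <> 0%VS -> i = j) ->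
  total_dim C = `|euler_delta C|%N.
Proof.
move=> Ht; rewrite total_dimE euler_deltaE.
suff : parity_dim true = 0%N \/ parity_dim false = 0%N by lia.
have sumP b : parity_dim b <> 0%N -> exists2 i, homology C i <> 0%VS & floor_odd i = b.
  move/eqP; rewrite sum_nat_seq_neq0 => /hasP[i _ /andP[/eqP <- Hd]].
  by exists i => //; apply/eqP; rewrite -dimv_eq0.
case: (eqVneq (parity_dim true) 0%N) => [|/eqP /sumP[i Hi ii]]; first by left.
case: (eqVneq (parity_dim false) 0%N) => [|/eqP /sumP[j Hj jj]]; first by right.
by move: jj; rewrite -(Ht i j Hi Hj) ii.
Qed.

Lemma homology_delta_gen i : homology C i <> 0%VS -> exists g : gen C, i = delta g.
Proof. by move/homology_deltas; rewrite mem_undup => /mapP[g _ ->]; exists g. Qed.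

(** The homological grading is an integer, so only half the difference of the
    quantum gradings matters. *)
Lemma delta_int (g g' : gen C) :
  odd `|qdeg g| = odd `|qdeg g'| -> delta g - delta g' \is a Num.int.
Proof.
move=> Hq; have [m qE] : exists m : int, qdeg g = qdeg g' + m * 2.
  exists ((qdeg g - qdeg g') %/ 2)%Z.
  by rewrite divzK ?addrNK // ?subrKC //; lia.
suff -> : delta g - delta g' = (m + hdeg g' - hdeg g)%:~R by rewrite intr_int.
by rewrite /delta qE rmorphB !rmorphD rmorphM /=; field.
Qed.

End Homology.

(** * Parity of the Alexander grading *)

Section GridStates.
Variable L : link.
Local Notation n := (arcs L).
Implicit Types x M : 'S_n.

Lemma card_swap (P : rel 'I_n) :
  #|[set p : 'I_n * 'I_n | P p.1 p.2]| = #|[set p : 'I_n * 'I_n | P p.2 p.1]|.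
Proof.
have swapK : involutive (fun p : 'I_n * 'I_n => (p.2, p.1)) by case.
by rewrite -(card_preimset _ (inv_inj swapK)); apply: eq_card => p; rewrite !inE.
Qed.

Lemma card_perm_pairs (P : rel 'I_n) x M :
  #|[set p : 'I_n * 'I_n | P (x p.1) (M p.2)]| = #|[set p : 'I_n * 'I_n | P p.1 p.2]|.
Proof.
have xM_inj : injective (fun p : 'I_n * 'I_n => (x p.1, M p.2)).
  by move=> [a b] [c d] [/perm_inj -> /perm_inj ->].
by rewrite -[RHS](card_preimset _ xM_inj); apply: eq_card => p; rewrite !inE.
Qed.

(** The pairs (i, j) with i <= j split according to x i <= M j or M j < x i, and
    the pairs with M j < x i split according to i <= j or j < i.  As x and M are
    bijections, the second family is as large as that of the pairs with j < i,
    which is smaller than the first by the n diagonal pairs.  Hence the two sets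
    counted by [southwest] differ in size by exactly n. *)
Lemma southwest_double x M :
  (southwest x M + n
   = 2 * #|[set p : 'I_n * 'I_n | (p.1 <= p.2)%N && (x p.1 <= M p.2)%N]|)%N.
Proof.
rewrite /southwest (card_swap (fun a b => (a < b)%N && (M a < x b)%N)).
set A := [set p : 'I_n * 'I_n | (p.1 <= p.2)%N && _].
set B := [set p : 'I_n * 'I_n | (p.2 < p.1)%N && _].
pose D := [set p : 'I_n * 'I_n | (p.1 <= p.2)%N && (M p.2 < x p.1)%N].
have cardAD : (#|A| + #|D| = #|[set p : 'I_n * 'I_n | (p.1 <= p.2)%N]|)%N.
  rewrite -(cardsID [set p : 'I_n * 'I_n | (x p.1 <= M p.2)%N]
                  [set p : 'I_n * 'I_n | (p.1 <= p.2)%N]).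
  by congr (_ + _)%N; apply: eq_card => p; rewrite !inE // -ltnNge andbC.
have cardBD : (#|B| + #|D| = #|[set p : 'I_n * 'I_n | (p.2 < p.1)%N]|)%N.
  rewrite -(card_perm_pairs (fun a b => (b < a)%N) x M).
  rewrite -(cardsID [set p : 'I_n * 'I_n | (p.2 < p.1)%N]
                  [set p : 'I_n * 'I_n | (M p.2 < x p.1)%N]).
  by congr (_ + _)%N; apply: eq_card => p; rewrite !inE -?leqNgt // andbC.
have cardT : (#|[set p : 'I_n * 'I_n | (p.1 <= p.2)%N]|
              = #|[set p : 'I_n * 'I_n | (p.2 < p.1)%N]| + n)%N.
  rewrite (card_swap (fun a b => (b < a)%N)).
  rewrite -(cardsID [set p : 'I_n * 'I_n | (p.1 < p.2)%N]).
  congr (_ + _)%N; first by apply: eq_card => p; rewrite !inE; lia.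
  have diag_inj : injective (fun i : 'I_n => (i, i)) by move=> i j [].
  rewrite -[RHS]card_ord -cardsT -(card_imset _ diag_inj); apply: eq_card => -[a b].
  rewrite !inE -leqNgt -eqn_leq /=; apply/idP/imsetP => [/eqP /val_inj ->|[i _ [-> ->]] //].
  by exists a.
lia.
Qed.

End GridStates.

Lemma alexander_odd (L : link) (x y : 'S_(arcs L)) :
  odd `|alexander x| = odd `|alexander y|.
Proof.
rewrite /alexander /maslov.
have := (southwest_double x (gridO L), southwest_double x (gridX L),
         southwest_double y (gridO L), southwest_double y (gridX L)).
by case=> -[[]]; lia.
Qed.

Lemma hfk_adeg_odd (L : link) (g g' : hfk_gen L) :
  odd `|hfk_adeg g| = odd `|hfk_adeg g'|.
Proof.
rewrite /hfk_adeg; case: (val g) (val g') => [x m] [y m'].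
by have := alexander_odd x y; lia.
Qed.

(** * The checkerboard colouring of a grid diagram *)

Section Khovanov.
Variable L : link.
Local Notation n := (arcs L).
Implicit Types (s : {set cell L}) (d e : dart L) (c : cell L).

Definition below_left (M : 'S_n) (a b : nat) : nat :=
  #|[set i : 'I_n | (i < a)%N && (M i < b)%N]|.

Lemma below_left_col (M : 'S_n) (i : 'I_n) b :
  below_left M i.+1 b = (below_left M i b + (M i < b))%N.
Proof.
rewrite /below_left (cardsD1 i) inE ltnSn /= addnC; congr (_ + _)%N.
by apply: eq_card => j; rewrite !inE ltnS [in RHS]ltn_neqAle andbA.
Qed.

Lemma below_left_inv (M : 'S_n) a b : below_left M a b = below_left M^-1%g b a.
Proof.
rewrite /below_left -[RHS](card_preimset _ (@perm_inj _ M)); apply: eq_card => i.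
by rewrite !inE permK andbC.
Qed.

Lemma below_left_row (M : 'S_n) a (j : 'I_n) :
  below_left M a j.+1 = (below_left M a j + (M^-1%g j < a))%N.
Proof. by rewrite !(below_left_inv M) below_left_col. Qed.

(** The parity of the number of vertical segments met by the horizontal ray going
    left from the lattice point (a, b), the south-west corner of the cell
    (a, b): a segment meets the ray when exactly one of its two markings lies
    below it. *)
Definition black (a b : nat) : bool :=
  odd (below_left (gridO L) a b + below_left (gridX L) a b).

Lemma black_col (i : 'I_n) b :
  black i.+1 b = black i b (+) ((gridO L i < b)%N (+) (gridX L i < b)%N).
Proof. by rewrite /black !below_left_col; lia. Qed.

Lemma black_row a (j : 'I_n) :
  black a j.+1
  = black a j (+) (((gridO L)^-1%g j < a)%N (+) ((gridX L)^-1%g j < a)%N).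
Proof. by rewrite /black !below_left_row; lia. Qed.

(** An edge of the lattice of cells crosses a side of a cell; it belongs to the
    diagram precisely when the two ends of this side have different colours. *)
Lemma occupiedE (a b : 'I_n) v u :
  occupied ((a, b), (v, u)) =
  if v then black a (b + u) != black a.+1 (b + u)
  else black (a + u) b != black (a + u) b.+1.
Proof.
have flip x y : (x != x (+) y) = y by case: x; case: y.
by case: v; rewrite ?black_col ?black_row flip; case: u;
  rewrite /= ?addn0 ?addn1; lia.
Qed.

Lemma is_crossingE c :
  is_crossing c = [forall d : side, occupied (c, d)].
Proof.
case: c => a b; rewrite /is_crossing /strictly_between /=.
apply/idP/forallP => [H [[] []] /=|H]; [lia..|].
have := (H (true, true), H (true, false), H (false, true), H (false, false)) => /=.
by case=> [[[/andP[_ b_lt] /andP[b_gt _]] /andP[_ a_lt]] /andP[a_gt _]];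
  rewrite a_gt a_lt b_gt b_lt.
Qed.

(** A dart is ingoing if walking along it towards the centre of its cell keeps
    black on the left. *)
Definition ingoing d : bool :=
  occupied d && (let: ((a, b), (v, u)) := d in
                 if v then black a.+1 (b + u) == u else black (a + u) b.+1 == ~~ u).

(** The other end of the arc of the smoothed diagram inside the cell.  A cell
    that meets the diagram and is not a crossing has exactly two occupied darts,
    so the end sought is the opposite dart or else the occupied one among the two
    perpendicular ones. *)
Definition partner s d : dart L :=
  let: (c, (v, u)) := d in
  if is_crossing c then (c, (~~ v, (c \in s) (+) u))
  else if occupied (c, (v, ~~ u)) then (c, (v, ~~ u))
  else (c, (~~ v, occupied (c, (~~ v, true)))).

(** At a crossing the four corners of the cell alternate in colour. *)
Lemma is_crossing_black (a b : 'I_n) :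
  is_crossing (a, b) = [&& black a b == black a.+1 b.+1, black a b.+1 == black a.+1 b
                         & black a b != black a.+1 b].
Proof.
rewrite is_crossingE; apply/forallP/idP => [H|H [[] []]].
- have := (H (true, true), H (true, false), H (false, true), H (false, false)).
  rewrite !occupiedE !addn0 !addn1.
  by case: (black a b); case: (black a.+1 b); case: (black a b.+1);
    case: (black a.+1 b.+1) => // -[[[]]].
all: move: H; rewrite occupiedE ?addn0 ?addn1;
  by case: (black a b); case: (black a.+1 b); case: (black a b.+1);
    case: (black a.+1 b.+1).
Qed.

Arguments occupied : simpl never.

(** All facts about a single cell depend only on the colours of its four corners
    and on the smoothing chosen there. *)
Ltac corner_cases s a b :=
  let p := fresh "p" in let q := fresh "q" in let r := fresh "r" in
  let t := fresh "t" in let cs := fresh "cs" in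
  case p: (black a b); case q: (black a.+1 b);
  case r: (black a b.+1); case t: (black a.+1 b.+1); case cs: ((a, b) \in s);
  rewrite ?occupiedE ?addn0 ?addn1 ?p ?q ?r ?t //=;
  (* One pass for each evaluation of [partner] or of a test on its result. *)
  do 4 rewrite ?/partner ?/ingoing ?occupiedE ?is_crossing_black
               ?addn0 ?addn1 ?p ?q ?r ?t ?cs /=.

(** The arc enters and leaves: with black on the left throughout, one of its ends
    is ingoing and the other is not, for either smoothing of a crossing. *)
Lemma partner_spec s d : occupied d ->
  [/\ occupied (partner s d), ingoing (partner s d) = ~~ ingoing d,
      partner s (partner s d) = d & joined s d (partner s d)].
Proof.
case: d => -[a b] [v u]; rewrite /joined; case: v; case: u;
by corner_cases s a b; rewrite ?eqxx.
Qed.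

Lemma joined_partner s d e :
  occupied d -> occupied e -> joined s d e -> e = d \/ e = partner s d.
Proof.
case: d e => -[a b] [v u] [c [v' u']]; rewrite /joined /=.
move=> Od Oe /andP[/eqP cE]; move: Oe; rewrite -{c}cE; move: Od.
case: v; case: u; case: v'; case: u'; corner_cases s a b;
by [left | right | ].
Qed.

(** * The circles of a state as the cycles of a permutation *)

(** A step out of the grid stays in place, but an edge of the diagram never
    leaves the grid ([step_occupied]). *)
Definition step (u : bool) (i : 'I_n) : 'I_n := insubd i (if u then i.+1 else i.-1).

(** The other half of the edge of the diagram that contains the dart. *)
Definition across d : dart L :=
  let: ((a, b), (v, u)) := d in
  (if v then (a, step u b) else (step u a, b), (v, ~~ u)).

Lemma step_occupied (a b : 'I_n) v u : occupied ((a, b), (v, u)) ->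
  let p := if v then b else a in (step u p + ~~ u = p + u)%N.
Proof.
rewrite /occupied /step val_insubd.
have := (ltn_ord (gridO L a), ltn_ord (gridX L a),
         ltn_ord ((gridO L)^-1%g b), ltn_ord ((gridX L)^-1%g b)).
by case=> [[[? ?] ?] ?]; case: v; case: u => /=; case: ifP; lia.
Qed.

Lemma step_eq u (i j : 'I_n) : (j + ~~ u = i + u)%N -> j = step u i.
Proof.
move=> ji; apply: val_inj; rewrite /= val_insubd.
by case: u ji => /=; case: ifP; have := ltn_ord j; lia.
Qed.

Lemma across_spec d : occupied d ->
  [/\ occupied (across d), ingoing (across d) = ~~ ingoing d,
      across (across d) = d & glued d (across d) || glued (across d) d].
Proof.
case: d => -[a b] [v u] Od; have := step_occupied Od; move: Od.
rewrite /across /ingoing /glued !occupiedE /=.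
case: v => /= Od stepE.
  have stepK : step (~~ u) (step u b) = b by apply/esym/step_eq; rewrite negbK -stepE.
  rewrite occupiedE stepE Od stepK negbK; split => //.
    by case: u (black _ _) {Od stepE stepK} => [] [].
  by move: stepE; case: u {Od stepK} => /= stepE; rewrite !eqxx /=; lia.
have stepK : step (~~ u) (step u a) = a by apply/esym/step_eq; rewrite negbK -stepE.
rewrite occupiedE stepE Od stepK negbK; split => //.
  by case: u (black _ _) {Od stepE stepK} => [] [].
by move: stepE; case: u {Od stepK} => /= stepE; rewrite !eqxx /=; lia.
Qed.

Lemma glued_across d e :
  occupied d -> occupied e -> glued d e || glued e d -> e = across d.
Proof.
case: d e => -[a b] [v u] [[a' b'] [v' u']] _ _; rewrite /glued /across /=.
case: v v' => [] [] //=; case: u u' => [] [] //=; rewrite ?orbF => /andP[/eqP H1 /eqP H2].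
- by rewrite H1 (@step_eq true b b') // H2 addn0 addn1.
- by rewrite -H1 (@step_eq false b b') // H2 addn0 addn1.
- by rewrite H2 (@step_eq true a a') // H1 addn0 addn1.
- by rewrite -H2 (@step_eq false a a') // H1 addn0 addn1.
Qed.

(** From an ingoing dart, follow the arc through the cell and go on into the next
    cell.  The other darts are fixed, which makes this a permutation of a type
    independent of the state. *)
Definition turn s d : dart L := if ingoing d then across (partner s d) else d.

Lemma ingoing_occupied d : ingoing d -> occupied d.
Proof. by case/andP. Qed.

Lemma ingoing_turn s d : ingoing (turn s d) = ingoing d.
Proof.
rewrite /turn; case: ifP => // Hd.
have [Op Ip _ _] := partner_spec s (ingoing_occupied Hd).
by have [_ -> _ _] := across_spec Op; rewrite Ip Hd.
Qed.

Lemma turn_inj s : injective (turn s).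
Proof.
move=> d e E.
have Ide : ingoing d = ingoing e by rewrite -(ingoing_turn s) E ingoing_turn.
move: E; rewrite /turn -Ide; case: ifP => // Id; move: (Id); rewrite Ide => Ie E.
have [Opd _ pdK _] := partner_spec s (ingoing_occupied Id).
have [Ope _ peK _] := partner_spec s (ingoing_occupied Ie).
have [_ _ adK _] := across_spec Opd; have [_ _ aeK _] := across_spec Ope.
by rewrite -pdK -adK E aeK peK.
Qed.

Definition turn_perm s : {perm dart L} := perm (@turn_inj s).

Definition inward d : dart L := if ingoing d then d else across d.

Lemma inward_ingoing d : occupied d -> ingoing (inward d).
Proof.
move=> Od; rewrite /inward; case: ifP => // Id.
by have [_ -> _ _] := across_spec Od; rewrite Id.
Qed.

Lemma adjacent_sym s : symmetric (adjacent s).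
Proof.
move=> d e; rewrite /adjacent /joined andbCA; congr [&& _, _ & _].
rewrite orbCA; congr [|| _, _ | _].
rewrite [e.1 == _]eq_sym [e.2.1 == _]eq_sym [e.2.2 == _]eq_sym.
by case: (d.1 =P e.1) => //= ->.
Qed.

Lemma connect_adjacent_sym s : connect_sym (adjacent s).
Proof. exact/sym_connect_sym/adjacent_sym. Qed.

Lemma connect_inward s d : occupied d -> connect (adjacent s) d (inward d).
Proof.
move=> Od; rewrite /inward; case: ifP => // _.
have [Oa _ _ gl] := across_spec Od.
by apply: connect1; rewrite /adjacent Od Oa orbA gl.
Qed.

Lemma connect_turn s d : connect (adjacent s) d (turn s d).
Proof.
rewrite /turn; case: ifP => // /ingoing_occupied Od.
have [Op _ _ jo] := partner_spec s Od; have [Oa _ _ gl] := across_spec Op.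
apply: (@connect_trans _ _ (partner s d)); apply: connect1.
  by rewrite /adjacent Od Op jo !orbT.
by rewrite /adjacent Op Oa orbA gl.
Qed.

Lemma porbit_turn s d : porbit (turn_perm s) (turn s d) = porbit (turn_perm s) d.
Proof. by rewrite -(porbit_perm _ 1 d) expg1 permE. Qed.

(** A walk in [adjacent s] may go backwards, but the cycle of the ingoing dart of
    the current edge is preserved at every step. *)
Lemma adjacent_porbit s d e : adjacent s d e ->
  porbit (turn_perm s) (inward d) = porbit (turn_perm s) (inward e).
Proof.
case/and3P=> Od Oe; rewrite orbA => /orP[gl|jo].
  rewrite (glued_across Od Oe gl) /inward.
  by have [_ -> -> _] := across_spec Od; case: (ingoing d).
have [->//|->] := joined_partner Od Oe jo.
have [Op Ip pK _] := partner_spec s Od.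
rewrite /inward Ip; case Id: (ingoing d) => /=.
  by rewrite -porbit_turn /turn Id.
by rewrite -[RHS]porbit_turn /turn Ip Id pK.
Qed.

Lemma connect_porbit s d e : ingoing d -> ingoing e ->
  connect (adjacent s) d e = (e \in porbit (turn_perm s) d).
Proof.
move=> Id Ie; apply/idP/idP => [/connectP[p dp eE]|/porbitP[i ->]].
  suff H : porbit (turn_perm s) (inward d) = porbit (turn_perm s) (inward e).
    by rewrite -eq_porbit_mem; move: H; rewrite /inward Id Ie => ->.
  rewrite eE; elim: p {Id Ie eE} d dp => //= f p IH d /andP[/adjacent_porbit -> /IH].
  by [].
elim: i => [|i IH]; first by rewrite expg0 perm1.
apply: connect_trans IH _; rewrite expgSr permM permE; exact: connect_turn.
Qed.

Lemma circle_porbit s d : ingoing d ->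
  circle s d :&: [set e | ingoing e] = porbit (turn_perm s) d.
Proof.
move=> Id; apply/setP=> e; rewrite !inE.
case Ie: (ingoing e); first by rewrite andbT connect_porbit.
rewrite andbF; apply/esym/negbTE/negP => /porbitP[i eE]; move: Ie; rewrite eE.
elim: i {eE} => [|i IH]; first by rewrite expg0 perm1 Id.
by rewrite expgSr permM permE ingoing_turn.
Qed.

Lemma circle_inward s d : occupied d -> circle s d = circle s (inward d).
Proof.
move=> Od; apply/setP=> e; rewrite !inE.
exact: (same_connect (@connect_adjacent_sym s) (connect_inward s Od)).
Qed.

Lemma circles_ingoing s : circles s = [set circle s d | d in [set d | ingoing d]].
Proof.
apply/setP=> A; apply/imsetP/imsetP => [[d]|[d]] /[!inE] Hd ->.
  by exists (inward d); rewrite ?inE ?inward_ingoing // -circle_inward.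
by exists d; rewrite ?inE ?ingoing_occupied.
Qed.

(** Every circle contains ingoing darts, and those form one cycle; the remaining
    cycles are the fixed darts. *)
Lemma card_porbits_turn s :
  #|porbits (turn_perm s)| = (#|circles s| + #|[set d : dart L | ~~ ingoing d]|)%N.
Proof.
pose I := [set d : dart L | ingoing d].
pose f := turn_perm s.
have -> : [set d : dart L | ~~ ingoing d] = ~: I by apply/setP=> d; rewrite !inE.
have -> : porbits f = porbit f @: I :|: porbit f @: (~: I).
  rewrite -imsetU setUCr /porbits.
  by apply/setP => A; apply/imsetP/imsetP => -[d _ ->]; exists d.
have onI : porbit f @: I = [set A :&: I | A in circles s].
  rewrite circles_ingoing -imset_comp; apply: eq_in_imset => d /[!inE] Id /=.
  by rewrite circle_porbit.
have offI : porbit f @: (~: I) = set1 @: (~: I).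
  apply: eq_in_imset => d /[!inE] Id; apply/setP => e; rewrite inE.
  have fd : f d = d by rewrite permE /turn (negbTE Id).
  apply/porbitP/eqP => [[i ->]|->]; last by exists 0%N; rewrite expg0 perm1.
  by elim: i => [|i IH]; rewrite ?expg0 ?perm1 // expgSr permM IH.
rewrite cardsU onI offI (_ : _ :&: _ = set0) ?cards0 ?subn0; last first.
  apply/setP=> X; rewrite inE [RHS]inE; apply/negP => /andP[/imsetP[A _ ->]] /imsetP[d].
  by rewrite !inE => /negP dI /setP/(_ d); rewrite !inE eqxx => /andP[_ /dI].
congr (_ + _)%N; last by rewrite card_imset //; apply: set1_inj.
apply: card_in_imset => A B; rewrite circles_ingoing => /imsetP[d /[!inE] Id ->].
move=> /imsetP[e /[!inE] Ie ->] /setP/(_ d); rewrite !inE Id connect0 !andbT => /esym de.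
apply/setP => g; rewrite !inE.
by rewrite (same_connect (@connect_adjacent_sym s) de).
Qed.

Lemma ingoing_crossing (a b : 'I_n) v u : is_crossing (a, b) ->
  ingoing ((a, b), (v, u)) = (v == black a.+1 b.+1).
Proof.
case: v; case: u; rewrite /ingoing occupiedE is_crossing_black ?addn0 ?addn1;
by case: (black a b); case: (black a.+1 b); case: (black a b.+1);
  case: (black a.+1 b.+1).
Qed.

(** The two ingoing darts at a crossing are opposite; the 0-smoothing and the
    1-smoothing join them to the two outgoing ones in the two possible ways. *)
Lemma turn_flip s c : is_crossing c -> c \notin s ->
  exists x y, x != y /\ turn_perm (c |: s) = (tperm x y * turn_perm s)%g.
Proof.
case: c => a b Hc cs; pose v := black a.+1 b.+1.
exists ((a, b), (v, true)), ((a, b), (v, false)).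
split; first by rewrite !xpair_eqE !eqxx.
have Ixy u : ingoing ((a, b), (v, u)) by rewrite ingoing_crossing.
apply/permP=> d; rewrite permM [LHS]permE [RHS]permE.
have [Id|nId] := boolP (ingoing d); last first.
  by rewrite tpermD; rewrite /turn ?(negbTE nId) //; apply: contraNneq nId => <-.
have [dc|dc] := eqVneq d.1 (a, b); last first.
  rewrite tpermD; try by apply: contraNneq dc => <-.
  rewrite /turn Id; congr across; case: d dc {Id} => c [w u] /= dc.
  by rewrite in_setU1 (negbTE dc).
case: d dc Id => _ [w u] /= -> Id; move: (Id); rewrite ingoing_crossing // => /eqP wv.
have flip u' : turn (((a, b)) |: s) ((a, b), (w, u')) = turn s ((a, b), (w, ~~ u')).
  rewrite /turn wv !Ixy; congr across.
  by rewrite /partner Hc setU11 (negbTE cs) /=.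
by rewrite flip wv; case: u {Id} => /=; rewrite ?tpermL ?tpermR.
Qed.

(** The signature of a permutation is the parity of the number of points plus the
    number of cycles, and a transposition changes it. *)
Lemma odd_circles_setU1 s c : is_crossing c -> c \notin s ->
  odd #|circles (c |: s)| = ~~ odd #|circles s|.
Proof.
move=> Hc cs; have [x [y [xy E]]] := turn_flip Hc cs.
have := congr1 (@odd_perm _) E; rewrite odd_permM odd_tperm xy /odd_perm.
rewrite !card_porbits_turn !oddD.
by case: odd; case: odd; case: odd; case: odd.
Qed.

Lemma odd_circles s : s \subset crossings L ->
  odd (#|circles s| + #|s|) = odd #|circles (set0 : {set cell L})|.
Proof.
elim: {s}#|s| {-2}s (erefl #|s|) => [|m IH] s sm sc.
  by move: sm => /eqP; rewrite cards_eq0 => /eqP ->; rewrite cards0 addn0.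
have [c cs] : exists c, c \in s by apply/set0Pn; rewrite -card_gt0 sm.
have Hc : is_crossing c by move/subsetP: sc => /(_ c cs); rewrite inE.
have cm : #|s :\ c| = m by move: sm; rewrite (cardsD1 c) cs => -[].
rewrite -(IH _ cm); last by apply: subset_trans (subsetDl _ _) sc.
by rewrite -{1}(setD1K cs) !oddD odd_circles_setU1 ?setD11 // cm sm /= addbN addNb negbK.
Qed.

(** The base point lies in the cell of an O, which is a corner of the diagram
    rather than a crossing, so a single arc passes through it in every state. *)
Lemma card_marked s : #|[set A in circles s | marked A]| = 1%N.
Proof.
pose c0 : cell L := (base L, gridO L (base L)).
pose d0 : dart L := (c0, (true, (gridO L (base L) < gridX L (base L))%N)).
have nc0 : ~~ is_crossing c0.
  by rewrite /is_crossing /strictly_between /=; lia.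
have Od0 : occupied d0.
  rewrite /occupied /=; have := gridOX (base L); rewrite -val_eqE /=.
  by case: ltnP => /=; lia.
rewrite -(cards1 (circle s d0)); apply: eq_card => A; rewrite !inE.
apply/andP/eqP => [[/imsetP[d /[!inE] Od ->] /exists_inP[e]]|->]; last first.
  split; first by apply: imset_f; rewrite inE.
  by apply/exists_inP; exists d0; rewrite ?inE ?connect0.
rewrite inE => de /eqP ec.
have Oe : occupied e.
  move: de; rewrite connect_adjacent_sym => /connectP[[|f p] /=]; first by move=> _ <-.
  by case/andP => /and3P[].
have ed : connect (adjacent s) e d0.
  by apply: connect1; rewrite /adjacent Oe Od0 /joined ec eqxx (negbTE nc0) !orbT.
apply/setP => g; rewrite !inE.
by rewrite (same_connect (@connect_adjacent_sym s) (connect_trans de ed)).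
Qed.

(** The marked circle is the only one that does not contribute 1 or -1, so the
    q-degree has the parity of the number of circles minus one, plus the number
    of 1-smoothings, plus a constant. *)
Lemma kh_qdeg_odd (g g' : kh_gen L) : odd `|kh_qdeg g| = odd `|kh_qdeg g'|.
Proof.
suff H (h : kh_gen L) : odd `|kh_qdeg h|
    = odd (#|circles (set0 : {set cell L})| + 1 + n_pos L).
  by rewrite !H.
case: h => -[s P] sP; have /and3P[sc _ nP] := sP.
rewrite /kh_qdeg /=.
have : #|circles s| = (#|plus_circles s P| + #|minus_circles s P| + 1)%N.
  rewrite -(card_marked s) -addnA
    -(cardsID [set A : {set dart L} | A \subset P] (circles s)).
  congr (_ + _)%N; first by apply: eq_card => A; rewrite !inE.
  rewrite -(cardsID [set A : {set dart L} | marked A] (circles s :\: _)) addnC.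
  congr (_ + _)%N; apply: eq_card => A; rewrite !inE.
    by rewrite andbC -andbA andbCA.
  case mA : (marked A); rewrite ?andbF ?andbT //.
  suff -> : (A \subset P) = false by [].
  apply: contraNF nP => AP; case/exists_inP: mA => d dA dc.
  by apply/exists_inP; exists d => //; apply: subsetP AP _ _.
have arith (t z c p m np nn : nat) : odd (c + t) = odd z -> c = (p + m + 1)%N ->
    odd `|(p%:Z - m%:Z + t%:Z + np%:Z - 2 * nn%:Z)%R| = odd (z + 1 + np) by lia.
exact: arith (odd_circles sc).
Qed.

End Khovanov.

(** * Thin links and A-links *)

Lemma delta_gen_int (k : fieldType) (H : theory) (L : link)
    (g g' : gen (complex_of k H L)) : delta g - delta g' \is a Num.int.
Proof.
case: H g g' => [|sg] g g'; apply: delta_int; first exact: kh_qdeg_odd.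
exact: hfk_adeg_odd.
Qed.

Theorem proposition1p5 (k : fieldType) (H : theory) :
  full_support k H -> forall L : link, thin k H L <-> A_link k H L.
Proof.
move=> full L; split=> [|AL i j]; first exact: total_dim_thin.
wlog ij : i j / i < j => [hwlog Si Sj|Si Sj].
  by case: (ltgtP i j) => // [lt_ij|lt_ji]; [|apply/esym]; apply: hwlog.
have [[g gE] [g' g'E]] := (homology_delta_gen Si, homology_delta_gen Sj).
have ij_int : j - i \is a Num.int by rewrite gE g'E delta_gen_int.
have ij_ge1 : i + 1 <= j.
  move: ij; rewrite addrC -lerBrDr -subr_gt0; case/intrP: ij_int => m ->.
  by rewrite ltr0z ler1z; lia.
have Si1 : supported k H L (i + 1).
  case: (ltgtP (i + 1) j) ij_ge1 => // [lt_i1j|-> //] _.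
  apply: (full L i (i + 1) j) => //; last by rewrite ltrDl.
    by rewrite addrC addKr rpred1.
  by rewrite opprD addrA rpredB ?rpred1.
have := floor_odd_support AL Si Si1.
by rewrite floor_oddD1; case: floor_odd.
Qed.
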